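(* Let $\mathbb{V}:\mathbb{R}^2\to\mathbb{C}^{2\times 2}$ be a bounded (measurable) matrix-valued potential. Let $\mathbb{U}=(\mathbb{U}_1,\mathbb{U}_2)\in H^1_{\mathrm{loc}}(\mathbb{R}^2)$ be a bounded real-valued weak solution (i.e. $\mathbb{U}_1$ and $\mathbb{U}_2$ take values in $\mathbb{R}$) of $(\mathcal{D}_2+\mathbb{V})\mathbb{U}=0$ in $\mathbb{R}^2$ with $|\mathbb{U}(0)|=1$. Then there exists $\kappa=\kappa(\|\mathbb{V}\|_{L^\infty})>0$ such that $$M_R[\mathbb{U}]\gtrsim \mathrm{e}^{-\kappa R\log R}\qquad\text{for }R\gg1,$$ that is, there exist constants $c>0$ and $R_0>1$, independent of $R$, such that $M_R[\mathbb{U}]\ge c\,\mathrm{e}^{-\kappa R\log R}$ for all $R\ge R_0$.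
   Context: The two-dimensional massless Dirac operator is $\mathcal{D}_2=-i\sigma_1\partial_1-i\sigma_2\partial_2$ with $\sigma_1=\begin{pmatrix}0&1\\1&0\end{pmatrix}$, $\sigma_2=\begin{pmatrix}0&-i\\ i&0\end{pmatrix}$; equivalently $\mathcal{D}_2=\begin{pmatrix}0&-i(\partial_1-i\partial_2)\\-i(\partial_1+i\partial_2)&0\end{pmatrix}$. A weak solution of $(\mathcal{D}_2+\mathbb{V})\mathbb{U}=0$ is a solution in the sense of distributions: $\int_{\mathbb{R}^2}\big(\langle \mathbb{U},\mathcal{D}_2\phi\rangle_{\mathbb{C}^2}+\langle \mathbb{V}\mathbb{U},\phi\rangle_{\mathbb{C}^2}\big)\,dx=0$ for all $\phi\in C_c^\infty(\mathbb{R}^2;\mathbb{C}^2)$ (for $\mathbb{U}\in H^1_{\mathrm{loc}}$, the equation holds almost everywhere). Such solutions have a locally Hölder continuous representative, and pointwise values of $\mathbb{U}$ refer to it. For $R>0$, $M_R[\mathbb{U}]:=\inf_{|x|=R}\big[\sup_{y\in B_1(x)}|\mathbb{U}(y)|\big]$, where $|\cdot|$ is the Euclidean norm and $B_1(x)$ is the open unit ball centered at $x$. *)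

(* Defs.v *)
From mathcomp Require Import all_boot all_order all_algebra.
From mathcomp Require Import all_classical all_reals all_analysis.
From mathcomp Require Import measurable_realfun complex.

Set Implicit Arguments.
Unset Strict Implicit.
Unset Printing Implicit Defensive.

Import Order.TTheory GRing.Theory Num.Theory.
Import numFieldNormedType.Exports.

Local Open Scope classical_set_scope.
Local Open Scope ring_scope.
Local Open Scope complex_scope.

(* The plane is R * R.  Its library norm is the max norm, which induces the
   right topology; Euclidean lengths are taken with [enorm].  A scalar field
   R * R -> R[i] is handled through its real and imaginary parts, because R[i]
   carries no topology or sigma-algebra in the library. *)

Section Dirac.
Variable R : realType.

Definition e1 : R * R := (1, 0).
Definition e2 : R * R := (0, 1).

Definition enorm (x : R * R) : R := Num.sqrt (x.1 ^+ 2 + x.2 ^+ 2).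

Definition leb2 : {measure set (measurableTypeR R * measurableTypeR R) -> \bar R} :=
  (@lebesgue_measure R \x @lebesgue_measure R)%E.

(* Measurability for the completion of the Borel sigma-algebra of the plane;
   [leb2] itself lives on the Borel sets. *)
Definition lmeasurable (f : R * R -> R) : Prop :=
  measurable_fun
    (setT : set (g_sigma_algebraType (completed_algebra_gen leb2))) f.

Definition clmeasurable (f : R * R -> R[i]) : Prop :=
  lmeasurable (fun x => complex.Re (f x)) /\
  lmeasurable (fun x => complex.Im (f x)).

Definition cintegral (f : R * R -> R[i]) : R[i] :=
  Rintegral leb2 setT (fun x => complex.Re (f x)) +i*
  Rintegral leb2 setT (fun x => complex.Im (f x)).

Definition ccontinuous (f : R * R -> R[i]) : Prop :=
  continuous (fun x => complex.Re (f x)) /\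
  continuous (fun x => complex.Im (f x)).

Definition cderive (v : R * R) (f : R * R -> R[i]) (x : R * R) : R[i] :=
  'D_v (fun y => complex.Re (f y)) x +i* 'D_v (fun y => complex.Im (f y)) x.

Fixpoint Cn (n : nat) (f : R * R -> R) : Prop :=
  continuous f /\
  if n is m.+1 then
    [/\ forall x, derivable f x e1, forall x, derivable f x e2,
        Cn m (fun x => 'D_e1 f x) & Cn m (fun x => 'D_e2 f x)]
  else True.

Definition smooth (f : R * R -> R) : Prop := forall n, Cn n f.

Definition test_function (psi : R * R -> R[i]) : Prop :=
  [/\ smooth (fun x => complex.Re (psi x)),
      smooth (fun x => complex.Im (psi x)) &
      compact (closure [set x | psi x != 0])].

Definition L2loc (f : R * R -> R[i]) : Prop :=
  clmeasurable f /\
  forall K : set (R * R), compact K ->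
    (\int[leb2]_(x in K) (Normc.normc (f x) ^+ 2)%:E < +oo)%E.

Definition weak_derivative (v : R * R) (f g : R * R -> R[i]) : Prop :=
  forall psi, test_function psi ->
    cintegral (fun x => f x * cderive v psi x) =
    - cintegral (fun x => g x * psi x).

Definition H1loc (f : R * R -> R[i]) : Prop :=
  L2loc f /\
  exists g1 g2, [/\ L2loc g1, L2loc g2,
    weak_derivative e1 f g1 & weak_derivative e2 f g2].

Definition cnorm (v : 'cV[R[i]]_2) : R :=
  Num.sqrt (\sum_j Normc.normc (v j 0) ^+ 2).

Definition cdot (u v : 'cV[R[i]]_2) : R[i] := \sum_(j < 2) u j 0 * conjc (v j 0).

Definition opnorm (A : 'M[R[i]]_2) : R :=
  sup [set cnorm (A *m v) | v in [set v | cnorm v <= 1]].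

Definition Linf_norm (V : R * R -> 'M[R[i]]_2) : \bar R :=
  ('N[leb2]_+oo[EFin \o (fun x => opnorm (V x))])%E.

Definition sigma1 : 'M[R[i]]_2 := \matrix_(i, j) (i != j)%:R.

Definition sigma2 : 'M[R[i]]_2 :=
  \matrix_(i, j) (if i == j then 0 else if i == 0 then - 'i%C else 'i%C).

Definition pderive (v : R * R) (phi : R * R -> 'cV[R[i]]_2) (x : R * R) :
    'cV[R[i]]_2 :=
  \col_j cderive v (fun y => phi y j 0) x.

Definition dirac2 (phi : R * R -> 'cV[R[i]]_2) (x : R * R) : 'cV[R[i]]_2 :=
  - 'i%C *: (sigma1 *m pderive e1 phi x) - 'i%C *: (sigma2 *m pderive e2 phi x).

Definition weak_solution (V : R * R -> 'M[R[i]]_2)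
    (U : R * R -> 'cV[R[i]]_2) : Prop :=
  forall phi : R * R -> 'cV[R[i]]_2,
    (forall j, test_function (fun x => phi x j 0)) ->
    cintegral (fun x => cdot (U x) (dirac2 phi x) + cdot (V x *m U x) (phi x))
    = 0.

(* M_r[U]; the real-valued [inf] and [sup] are the true ones for continuous U
   and 0 < r: the suprema are then finite and nonnegative. *)
Definition Mmin (U : R * R -> 'cV[R[i]]_2) (r : R) : R :=
  inf [set sup [set cnorm (U y) | y in [set y | enorm (y - x) < 1]]
      | x in [set x | enorm x = r]].

End Dirac.

(* Main.v *)
Require Import Defs.
From mathcomp Require Import all_boot all_order all_algebra.
From mathcomp Require Import all_classical all_reals all_analysis.
From mathcomp Require Import measurable_realfun ess_sup_inf complex.
From mathcomp Require Import ring lra.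

Set Implicit Arguments.
Unset Strict Implicit.
Unset Printing Implicit Defensive.

Import Order.TTheory GRing.Theory Num.Theory.
Import numFieldNormedType.Exports.

Local Open Scope classical_set_scope.
Local Open Scope ring_scope.

(** For a real spinor the system controls the whole gradient.  It reads
      [(d1 + i d2) U_1 = - i (V U)_2]  and  [(d1 - i d2) U_2 = - i (V U)_1].
    As [U_1] and [U_2] are real, the left-hand sides have modulus [|grad U_1|]
    and [|grad U_2|], so that
      [|grad U| <= |V|_oo |U|]
    holds almost everywhere, and Gronwall's inequality along a path from the
    origin gives [|U x| >= c exp (- C |x|)].  This is stronger than the claim,
    and the lower bound at the center of a ball bounds the supremum on the ball.

    The work consists in running this argument from the distributional equation.
    [dirac_weak_slope] extracts from it, by testing with [i psi] for a real
    [psi], the weak form of [|D_k U_i| <= (|V|_oo + 1) |U|].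
    [weak_slope_increment] converts such a weak bound for a continuous function
    into a bound of its increments along axis-parallel segments; its test
    functions are products of smooth plateaus and bumps, built from
    [exp (-1/x)].  The integrals met there need not have Borel integrands, so
    they are only compared with explicit ones ([Rintegral_squeeze]).

    With [w = |U_1| + |U_2|], an increment bound in terms of the supremum of [w]
    shows that [w] changes at most by a factor 2 along a segment of length
    [1 / (4 M)] ([doubling]); an axis-parallel path from the origin to [x] is
    covered by [O(M |x|)] such segments ([exp_lower_bound]). *)

(** * A compactly supported smooth bump on the line *)

Section SmoothLine.
Variable R : realType.
Implicit Types (f g : R -> R) (x : R) (n k : nat).

(** Witnessing each derivative by a function keeps the closure lemmas free of
    higher derivative operators: every one of them is an induction on [n]. *)
Fixpoint nderivable n f : Prop :=
  if n is m.+1 then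
    exists2 f' : R -> R, (forall x : R, is_derive x (1 : R) f (f' x)) & nderivable m f'
  else True.

Lemma nderivable_pred n f : nderivable n.+1 f -> nderivable n f.
Proof.
elim: n f => [//|n IH] f [f' df Hf']; exists f' => //; exact: IH.
Qed.

Lemma nderivable_cst n (c : R) : nderivable n (fun=> c).
Proof.
elim: n c => [//|n IH] c; exists (fun=> 0) => // x; exact: is_derive_cst.
Qed.

Lemma nderivable_add n f g : nderivable n f -> nderivable n g -> nderivable n (fun x => f x + g x).
Proof.
elim: n f g => [//|n IH] f g [f' df Hf'] [g' dg Hg'].
by exists (fun x => f' x + g' x); [move=> x; exact: is_deriveD | exact: IH].
Qed.

Lemma nderivable_mul n f g : nderivable n f -> nderivable n g -> nderivable n (fun x => f x * g x).
Proof.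
elim: n f g => [//|n IH] f g Hf Hg.
have [f' df Hf'] := Hf; have [g' dg Hg'] := Hg.
exists (fun x => f x * g' x + g x * f' x).
  by move=> x; exact: is_deriveM.
by apply: nderivable_add; apply: IH => //; exact: nderivable_pred.
Qed.

Lemma nderivable_inv n f : (forall x, f x != 0) -> nderivable n f ->
  nderivable n (fun x => (f x)^-1).
Proof.
elim: n f => [//|n IH] f f0 Hf.
have [f' df Hf'] := Hf.
have Hi : nderivable n (fun x => (f x)^-1) by apply: IH => //; exact: nderivable_pred.
exists (fun x => - 1 * ((f x)^-1 * (f x)^-1) * f' x).
  move=> x; apply: (is_derive_eq (is_deriveV (f0 x) (df x))).
  by rewrite /GRing.scale/= expr2 invfM; ring.
by apply: nderivable_mul => //; apply: nderivable_mul;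
  [exact: nderivable_cst|exact: nderivable_mul].
Qed.

Lemma nderivable_affine n f (a b : R) : nderivable n f -> nderivable n (fun x => f (a * x + b)).
Proof.
elim: n f => [//|n IH] f [f' df Hf'].
exists (fun x => f' (a * x + b) * a).
  move=> x.
  have h : is_derive x (1 : R) (fun x => a * x + b) a.
    have h := is_deriveD (is_deriveZ a (is_derive_id x (1:R))) (is_derive_cst b x (1:R)).
    by apply: (is_derive_eq h); rewrite addr0 /GRing.scale/= mulr1.
  exact: (is_derive1_comp (df _) h).
by apply: nderivable_mul; [exact: IH | exact: nderivable_cst].
Qed.

(** The classical flat function [exp(-1/x)] together with the factors [x^-n]
    that its derivatives produce: this family is stable under differentiation
    up to linear combinations, which makes smoothness an immediate induction. *)
Definition flat (n : nat) (x : R) : R := if 0 < x then x ^- n * expR (- x^-1) else 0.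

Lemma flat_ge0 n x : 0 <= flat n x.
Proof.
by rewrite /flat; case: ifPn => // x0; rewrite mulr_ge0 ?invr_ge0 ?exprn_ge0 ?expR_ge0// ltW.
Qed.

(** With [y = 1/x], this is [y^(n+2)/(n+2)! <= exp y]; the spare factor [x^2]
    makes the difference quotient at the origin tend to 0. *)
Lemma flat_le n x : flat n x <= (n.+2)`!%:R * x ^+ 2.
Proof.
rewrite /flat; case: ifPn => [x0|_]; last by rewrite mulr_ge0 ?sqr_ge0.
have y0 : 0 < x^-1 by rewrite invr_gt0.
have := expR_ge1Dxn n.+1 (ltW y0) => h.
have fp : 0 < (n.+2)`!%:R :> R by rewrite ltr0n fact_gt0.
rewrite expRN ler_pdivrMr ?expR_gt0//.
have {}h : x^-1 ^+ n.+2 <= (n.+2)`!%:R * expR x^-1.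
  by rewrite -ler_pdivrMl// mulrC (le_trans _ h)// lerDr.
have -> : x ^- n = x ^+ 2 * x^-1 ^+ n.+2.
  rewrite -(addn2 n) exprVn exprD; field; rewrite ?expf_neq0 ?gt_eqF//.
by apply: (le_trans (ler_wpM2l (sqr_ge0 x) h)); rewrite le_eqVlt; apply/orP; left;
apply/eqP; ring.
Qed.

Lemma is_derive_flat n x :
  is_derive x (1:R) (flat n) (- n%:R * flat n.+1 x + flat n.+2 x).
Proof.
have [x0|x0|->] := ltgtP x 0.
- rewrite /flat ltNge (ltW x0)/= mulr0 addr0.
  have h : is_derive x (1:R) (fun=> 0 : R) (0 : R) by exact: is_derive_cst.
  apply: (near_eq_is_derive _ h).
  near=> y; have -> // : (0 < y) = false.
  apply/negbTE; rewrite -leNgt ltW//; near: y; exact: lt_nbhsl.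
- have h : is_derive x (1:R) (fun x => x ^- n * expR (- x^-1))
     (- n%:R * flat n.+1 x + flat n.+2 x).
    have xn0 : x != 0 by rewrite gt_eqF.
    have h1 : is_derive x (1:R) (fun x => x^-1) (- x ^- 2).
      by apply: (is_derive_eq (is_deriveV xn0 (is_derive_id x (1:R)))); rewrite /GRing.scale/= mulr1.
    have h2 : is_derive x (1:R) (fun x => - x^-1) (x ^- 2).
      by apply: (is_derive_eq (is_deriveN h1)); rewrite opprK.
    have h3 := is_derive1_comp (is_derive_expR _) h2.
    have h4 : is_derive x (1:R) (fun x => x ^- n) (- n%:R * x ^- n.+1).
      elim: n => [|n IH].
        by rewrite oppr0 mul0r; exact: (is_derive_cst (1^-1 : R) x (1:R)).
      rewrite (_ : (fun y : R => y ^- n.+1) = (fun y => y^-1 * y ^- n)); last first.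
        by apply/funext => y; rewrite exprS invfM.
      apply: (is_derive_eq (is_deriveM h1 IH)).
      by rewrite /GRing.scale/= -natr1 !exprS expr0; field; rewrite ?expf_neq0 ?xn0.
    apply: (is_derive_eq (is_deriveM h4 h3)).
    rewrite /GRing.scale/= /flat x0.
    rewrite !exprS expr0; field; rewrite ?expf_neq0 ?xn0//.
  apply: (near_eq_is_derive _ h).
  near=> y; rewrite /flat.
  have -> // : 0 < y.
  near: y; exact: lt_nbhsr.
- have e m : flat m 0 = 0 by rewrite /flat ltxx.
  rewrite !e mulr0 addr0.
  suff h : h^-1 *: (flat n (h *: (1 : R) + 0) - flat n 0) @[h --> (0 : R)^'] --> (0 : R).
    split; first by apply/cvg_ex; exists 0.
    exact: cvg_lim h.
  have fp : 0 < (n.+2)`!%:R :> R by rewrite ltr0n fact_gt0.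
  apply/cvgrPdist_le => d d0; near=> t.
  rewrite e sub0r normrN subr0 addr0 /GRing.scale/= mulr1 normrM normfV.
  have t0 : t != 0 by near: t; exact: nbhs_dnbhs_neq.
  rewrite (ger0_norm (flat_ge0 _ _)) mulrC ler_pdivrMr ?normr_gt0//.
  rewrite (le_trans (flat_le _ _))// -(real_normK (num_real t)) expr2 mulrA.
  rewrite ler_wpM2r// -ler_pdivlMl// mulrC.
  by near: t; apply: dnbhs0_le; rewrite divr_gt0.
Unshelve. all: by end_near. Qed.

Lemma nderivable_flat k n : nderivable k (flat n).
Proof.
elim: k n => [//|k IH] n.
exists (fun x => - n%:R * flat n.+1 x + flat n.+2 x); first exact: is_derive_flat.
by apply: nderivable_add => //; apply: nderivable_mul => //; exact: nderivable_cst.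
Qed.

Lemma flat_gt0 n x : 0 < x -> 0 < flat n x.
Proof. by move=> x0; rewrite /flat x0 mulr_gt0 ?invr_gt0 ?exprn_gt0 ?expR_gt0. Qed.

Lemma flat_eq0 n x : x <= 0 -> flat n x = 0.
Proof. by rewrite /flat ltNge => ->. Qed.

(** A smooth transition from 0 (for [x <= 0]) to 1 (for [1 <= x]); the
    denominator is positive because [x] and [1 - x] are never both [<= 0].
    Its derivative [bump] is the mollifier of the proof: its integral comes for
    free from the fundamental theorem of calculus. *)
Definition step x : R := flat 0 x / (flat 0 x + flat 0 (1 - x)).

Lemma step_den_gt0 x : 0 < flat 0 x + flat 0 (1 - x).
Proof.
have [x0|x0] := ltP 0 x; first by rewrite ltr_pwDl ?flat_gt0 ?flat_ge0.
by rewrite ltr_wpDl ?flat_ge0 ?flat_gt0//; lra.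
Qed.

Lemma step_le0 x : x <= 0 -> step x = 0.
Proof. by move=> x0; rewrite /step (flat_eq0 0 x0) mul0r. Qed.

Lemma step_ge1 x : 1 <= x -> step x = 1.
Proof.
move=> x1; rewrite /step (flat_eq0 0 (_ : 1 - x <= 0)) ?addr0 ?divff//; last by lra.
by rewrite gt_eqF// flat_gt0//; lra.
Qed.

Lemma step_ge0 x : 0 <= step x.
Proof. by rewrite mulr_ge0 ?flat_ge0// invr_ge0 ltW ?step_den_gt0. Qed.

Lemma step_le1 x : step x <= 1.
Proof. by rewrite /step ler_pdivrMr ?step_den_gt0// mul1r lerDl flat_ge0. Qed.

Lemma nderivable_step n : nderivable n step.
Proof.
apply: nderivable_mul; first exact: nderivable_flat.
apply: nderivable_inv; first by move=> x; rewrite gt_eqF ?step_den_gt0.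
apply: nderivable_add; first exact: nderivable_flat.
rewrite (_ : (fun x => flat 0 (1 - x)) = fun x => flat 0 (-1 * x + 1)).
  exact/nderivable_affine/nderivable_flat.
by apply/funext => x; congr flat; ring.
Qed.

Definition bump x : R := derive1 step x.

Lemma is_derive_step x : is_derive x (1 : R) step (bump x).
Proof.
have [f' df _] := nderivable_step 1.
by rewrite /bump derive1E; apply/derivableP; case: (df x).
Qed.

Lemma nderivable_bump n : nderivable n bump.
Proof.
have [f' df Hf'] := nderivable_step n.+1.
rewrite (_ : bump = f')//; apply/funext => x.
by rewrite /bump derive1E; case: (df x).
Qed.

Lemma flat0_homo : {homo flat 0 : x y / x <= y}.
Proof.
move=> x y xy; have [x0|x0] := leP x 0; first by rewrite (flat_eq0 0 x0) flat_ge0.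
have y0 := lt_le_trans x0 xy.
rewrite /flat x0 y0 !expr0 invr1 !mul1r ler_expR lerN2.
by rewrite lef_pV2// posrE.
Qed.

Lemma step_homo : {homo step : x y / x <= y}.
Proof.
move=> x y xy; rewrite /step ler_pdivrMr ?step_den_gt0//.
rewrite mulrAC ler_pdivlMr ?step_den_gt0// !mulrDr [X in X + _ <= _]mulrC lerD2l.
by apply: ler_pM; rewrite ?flat_ge0//; apply: flat0_homo; lra.
Qed.

Lemma bump_ge0 x : 0 <= bump x.
Proof.
rewrite /bump derive1E.
have [dx _] := is_derive_step x.
apply: (limr_ge dx).
near=> h.
have h0 : h != 0 by near: h; exact: nbhs_dnbhs_neq.
rewrite /= /GRing.scale/= mulr1; have [h1|h1] := ltP 0 h.
  apply: mulr_ge0; first by rewrite invr_ge0 ltW.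
  by rewrite subr_ge0; apply: step_homo; lra.
apply: mulr_le0; first by rewrite invr_le0.
by rewrite subr_le0; apply: step_homo; lra.
Unshelve. all: by end_near. Qed.

Lemma bump_out x : (x < 0) || (1 < x) -> bump x = 0.
Proof.
rewrite /bump derive1E => /orP[x0|x1].
  rewrite (near_eq_derive (g := cst (0 : R))) ?derive_cst//.
  near=> y; rewrite step_le0//= ltW//; near: y; exact: lt_nbhsl.
rewrite (near_eq_derive (g := cst (1 : R))) ?derive_cst//.
near=> y; rewrite step_ge1//= ltW//; near: y; exact: lt_nbhsr.
Unshelve. all: by end_near. Qed.

End SmoothLine.

(** * Tensor products as test functions on the plane *)

Section Tensor.
Variable R : realType.
Implicit Types (p q : R -> R) (x : R * R).

(** [p] is evaluated at the coordinate along [axis k] and [q] at the other one,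
    so that both partial derivatives are treated by one argument. *)
Definition tensor (k : bool) p q x : R := if k then q x.1 * p x.2 else p x.1 * q x.2.

Definition axis (k : bool) : R * R := if k then e2 R else e1 R.

Lemma tensorC k p q : tensor (~~ k) q p = tensor k p q.
Proof. by apply/funext => x; rewrite /tensor; case: k => /=. Qed.

Lemma is_derive_tensor k p p' q x :
  (forall s : R, is_derive s (1 : R) p (p' s)) ->
  is_derive x (axis k) (tensor k p q) (tensor k p' q x).
Proof.
move=> dp.
set c := if k then x.2 else x.1; set d := if k then q x.1 else q x.2.
have [dc ec] := dp c.
have h : h^-1 *: (tensor k p q (h *: axis k + x) - tensor k p q x) @[h --> (0 : R)^']
    --> tensor k p' q x.
  rewrite (_ : tensor k p' q x = d * p' c); last first.
    by rewrite /tensor /d /c; case: (k); rewrite // mulrC.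
  rewrite (_ : (fun h : R => _) =
    (fun h => d * (h^-1 *: (p (h *: 1 + c) - p c)))); last first.
    apply/funext => h; rewrite /GRing.scale/= /tensor /d /c /axis.
    by case: (k) => /=; rewrite /GRing.scale/= mulr0 add0r; ring.
  by apply: cvgM; [exact: cvg_cst | rewrite -ec].
split; first by apply/cvg_ex; exists (tensor k p' q x).
exact: cvg_lim h.
Qed.

Lemma nderivable_continuous n p : nderivable n.+1 p -> continuous p.
Proof.
move=> [p' dp _] s; apply: differentiable_continuous.
by apply/derivable1_diffP; case: (dp s).
Qed.

Lemma continuous_tensor k p q : continuous p -> continuous q ->
  continuous (tensor k p q).
Proof.
move=> cp cq; wlog -> : k p q cp cq / k = false.
  move=> H; case: k; last exact: H.
  by rewrite -tensorC; exact: H.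
move=> x; rewrite /tensor.
apply: cvgM.
  apply: (@cvg_comp _ _ _ fst p _ (nbhs x.1)); [exact: cvg_fst | exact: cp].
apply: (@cvg_comp _ _ _ snd q _ (nbhs x.2)); [exact: cvg_snd | exact: cq].
Qed.

Lemma Cn_tensor n p q : nderivable n.+1 p -> nderivable n.+1 q -> Cn n (tensor false p q).
Proof.
elim: n p q => [|n IH] p q Hp Hq.
  by split => //; apply: continuous_tensor;
    [exact: nderivable_continuous Hp|exact: nderivable_continuous Hq].
have [p' dp Hp'] := Hp; have [q' dq Hq'] := Hq.
have d1 x := is_derive_tensor false q x dp.
have d2 x : is_derive x (e2 R) (tensor false p q) (tensor false p q' x).
  by rewrite -!(tensorC false); exact: (is_derive_tensor true p x dq).
split; first by apply: continuous_tensor;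
    [exact: nderivable_continuous Hp|exact: nderivable_continuous Hq].
split.
- by move=> x; case: (d1 x).
- by move=> x; case: (d2 x).
- rewrite (_ : (fun x => _) = tensor false p' q).
    by apply: IH => //; exact: nderivable_pred.
  by apply/funext => x; case: (d1 x).
- rewrite (_ : (fun x => _) = tensor false p q').
    by apply: IH => //; exact: nderivable_pred.
  by apply/funext => x; case: (d2 x).
Qed.

Lemma smooth_tensor k p q : (forall n, nderivable n p) -> (forall n, nderivable n q) ->
  smooth (tensor k p q).
Proof.
by move=> Hp Hq n; case: k; [rewrite -tensorC|]; exact: Cn_tensor.
Qed.

Lemma compact_closure_box (A : set (R * R)) (m : R) :
  (forall x, A x -> - m <= x.1 <= m /\ - m <= x.2 <= m) -> compact (closure A).
Proof.
move=> H; have cK : compact (`[- m, m]%classic `*` `[- m, m]%classic : set (R * R)).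
  by apply: compact_setX; exact: segment_compact.
apply: (subclosed_compact _ cK); first exact: closed_closure.
have -> : `[- m, m]%classic `*` `[- m, m]%classic =
    closure (`[- m, m]%classic `*` `[- m, m]%classic : set (R * R)).
  apply/closure_id; apply: (compact_closed _ cK); exact: norm_hausdorff.
by apply: closure_subset => x /H [h1 h2]; split; rewrite /= in_itv.
Qed.

End Tensor.

(** * Comparison of integrals without measurability *)

Section LowerIntegral.
Context d (T : measurableType d) (R : realType).
Variable mu : {measure set T -> \bar R}.
Import HBNNSimple.

(** The integral of a nonnegative function is the supremum of the integrals of
    the simple functions below it; cutting a simple function off on a null set
    changes neither its integral nor its being below [f].  Hence monotonicity
    holds for arbitrary, possibly non measurable, [f] and [g]. *)
Lemma ge0_le_integral_ae (f g : T -> \bar R) (N : set T) :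
  measurable N -> mu N = 0%E -> (forall x, 0 <= f x)%E -> (forall x, 0 <= g x)%E ->
  (forall x, ~ N x -> (f x <= g x)%E) ->
  (\int[mu]_x f x <= \int[mu]_x g x)%E.
Proof.
move=> mN N0 f0 g0 fg; rewrite !ge0_integralTE//.
apply: ge_ereal_sup => _ [h /= hf <-].
have mD : measurable (~` N) by exact: measurableC.
apply: ereal_sup_ubound; exists (proj_nnsfun h mD) => /=.
  move=> x; rewrite /= mindicE in_setC; have [Nx|Nx] := boolP (x \in N).
    by rewrite mulr0.
  by rewrite mulr1 (le_trans (hf x))// fg// => /mem_set; exact/negP.
rewrite -(mrestrict h mD) -integral_nnsfun// -setTD.
rewrite -(ge0_negligible_integral mN)//; last 2 first.
  exact/measurable_EFinP.
  by move=> x _; rewrite lee_fin.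
by rewrite integral_nnsfun// patch_setT.
Qed.

Lemma integral_le_ae (f g : T -> R) (N : set T) :
  measurable N -> mu N = 0%E -> (forall x, ~ N x -> f x <= g x) ->
  (\int[mu]_x (f x)%:E <= \int[mu]_x (g x)%:E)%E.
Proof.
move=> mN N0 fg; rewrite integralE [leRHS]integralE.
apply: leeB; apply: (ge0_le_integral_ae mN N0) => // x Nx.
  by rewrite !funeposE -!EFin_max lee_fin ge_max !le_max lexx orbT (fg x Nx).
by rewrite !funenegE -!EFinN -!EFin_max lee_fin ge_max !le_max lexx orbT lerN2 (fg x Nx).
Qed.

(** The integrand of the weak equation contains [V], which is measurable only
    for the completed sigma-algebra.  Bounding it between two Borel functions
    gives all that is needed about its integral. *)
Lemma Rintegral_squeeze (l h u : T -> R) (N : set T) :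
  measurable N -> mu N = 0%E ->
  mu.-integrable setT (EFin \o l) -> mu.-integrable setT (EFin \o u) ->
  (forall x, ~ N x -> l x <= h x <= u x) ->
  Rintegral mu setT l <= Rintegral mu setT h <= Rintegral mu setT u.
Proof.
move=> mN N0 il iu H.
have Hl : (\int[mu]_x (l x)%:E <= \int[mu]_x (h x)%:E)%E.
  by apply: (integral_le_ae mN N0) => x /H/andP[].
have Hu : (\int[mu]_x (h x)%:E <= \int[mu]_x (u x)%:E)%E.
  by apply: (integral_le_ae mN N0) => x /H/andP[].
have fl := integrable_fin_num measurableT il.
have fu := integrable_fin_num measurableT iu.
have fh : (\int[mu]_x (h x)%:E)%E \is a fin_num.
  rewrite fin_numElt (lt_le_trans _ Hl) ?(le_lt_trans Hu)//.
    by move: fu; rewrite fin_numElt => /andP[].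
  by move: fl; rewrite fin_numElt => /andP[].
by rewrite /Rintegral !fine_le.
Qed.

End LowerIntegral.

(** * Integrals of tensor products and rescaled bumps *)

Section Integrals.
Variable R : realType.
Local Notation mu := (@lebesgue_measure R).

Lemma integral_tensor k (p q : R -> R) (P Q : R) :
  measurable_fun setT p -> measurable_fun setT q ->
  (forall s, 0 <= p s) -> (forall s, 0 <= q s) ->
  (\int[mu]_s (p s)%:E = P%:E)%E -> (\int[mu]_s (q s)%:E = Q%:E)%E ->
  (@leb2 R).-integrable setT (EFin \o tensor k p q) /\
  Rintegral (@leb2 R) setT (tensor k p q) = P * Q.
Proof.
wlog -> : k p q P Q / k = false.
  move=> H mp mq p0 q0 iP iQ; case: k; last exact: H.
  by rewrite -tensorC mulrC; exact: H.
move=> mp mq p0 q0 iP iQ.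
have m2 : measurable_fun setT
    (EFin \o tensor false p q : measurableTypeR R * measurableTypeR R -> _).
  apply/measurable_EFinP; apply: measurable_funM.
    exact: measurableT_comp mp _.
  exact: measurableT_comp mq _.
have t0 x : (0 <= (EFin \o tensor false p q) x)%E by rewrite /= lee_fin mulr_ge0.
have I : (\int[@leb2 R]_x (EFin \o tensor false p q) x = (P * Q)%:E)%E.
  rewrite /leb2 fubini_tonelli1// /fubini_F.
  under eq_integral => s _.
    rewrite /= /tensor/=.
    under eq_integral do rewrite EFinM.
    rewrite ge0_integralZl//; last 3 first.
      exact/measurable_EFinP.
      by move=> t _; rewrite lee_fin.
      by rewrite lee_fin.
    rewrite iQ.
    over.
  rewrite ge0_integralZr ?iP//.
    exact/measurable_EFinP.
    by move=> s _; rewrite lee_fin.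
  rewrite -iQ; apply: integral_ge0 => s _; by rewrite lee_fin.
split; last by rewrite /Rintegral I.
apply/integrableP; split => //.
under eq_integral do rewrite gee0_abs//.
by rewrite I ltry.
Qed.

Implicit Types e c s : R.

(** The bump and the step rescaled to the interval [[c, c + e]]. *)
Definition bumpat (e c s : R) : R := e^-1 * bump (e^-1 * s + - (e^-1 * c)).
Definition stepat (e c s : R) : R := step (e^-1 * s + - (e^-1 * c)).

Lemma nderivable_stepat e c n : nderivable n (stepat e c).
Proof. exact/nderivable_affine/nderivable_step. Qed.

Lemma nderivable_bumpat e c n : nderivable n (bumpat e c).
Proof. by apply: nderivable_mul; [exact: nderivable_cst | exact/nderivable_affine/nderivable_bump]. Qed.

Lemma is_derive_stepat e c s : is_derive s (1 : R) (stepat e c) (bumpat e c s).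
Proof.
have h := is_deriveD (is_deriveZ e^-1 (is_derive_id s (1:R)))
  (is_derive_cst (- (e^-1 * c)) s (1:R)).
have h2 : is_derive s (1 : R) (fun s => e^-1 * s + - (e^-1 * c)) e^-1.
  by apply: (is_derive_eq h); rewrite addr0 /GRing.scale/= mulr1.
have := @is_derive1_comp _ (@step R) _ _ _ _ (is_derive_step _) h2.
by move=> h3; apply: (is_derive_eq h3); rewrite /bumpat mulrC.
Qed.

Lemma stepat_arg (e c s : R) : 0 < e -> e^-1 * s + - (e^-1 * c) = (s - c) / e.
Proof. by move=> e0; rewrite mulrBl; congr (_ - _); rewrite mulrC. Qed.

Lemma bumpat_ge0 e c s : 0 < e -> 0 <= bumpat e c s.
Proof. by move=> e0; rewrite mulr_ge0 ?bump_ge0// invr_ge0 ltW. Qed.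

Lemma bumpat_out e c s : 0 < e -> (s < c) || (c + e < s) -> bumpat e c s = 0.
Proof.
move=> e0 H; rewrite /bumpat stepat_arg// bump_out ?mulr0//.
by rewrite ltr_pdivrMr// mul0r subr_lt0 ltr_pdivlMr// mul1r ltrBrDl.
Qed.

Lemma stepat_le e c s : 0 < e -> s <= c -> stepat e c s = 0.
Proof.
by move=> e0 H; rewrite /stepat stepat_arg// step_le0// ler_pdivrMr// mul0r subr_le0.
Qed.

Lemma stepat_ge e c s : 0 < e -> c + e <= s -> stepat e c s = 1.
Proof.
by move=> e0 H; rewrite /stepat stepat_arg// step_ge1// ler_pdivlMr// mul1r lerBrDl.
Qed.

Lemma continuous_bumpat e c : continuous (bumpat e c).
Proof. exact: (nderivable_continuous (nderivable_bumpat e c 1)). Qed.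

Lemma continuous_stepat e c : continuous (stepat e c).
Proof. exact: (nderivable_continuous (nderivable_stepat e c 1)). Qed.

Lemma integral_bumpat e c : 0 < e -> (\int[mu]_s (bumpat e c s)%:E = 1)%E.
Proof.
move=> e0; have -> : (\int[mu]_s (bumpat e c s)%:E =
    \int[mu]_(s in `[c, (c + e)%R]) (bumpat e c s)%:E)%E.
  rewrite [RHS]integral_mkcond; apply: eq_integral => s _.
  rewrite patchE; case: ifPn => // sI; rewrite bumpat_out//.
  apply: contraNT sI; rewrite negb_or -!leNgt => /andP[h1 h2].
  by rewrite inE/= in_itv/= h1.
rewrite (@continuous_FTC2 _ _ (stepat e c)).
- by rewrite stepat_ge// stepat_le// sube0.
- by rewrite ltrDl.
- exact/continuous_subspaceT/continuous_bumpat.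
- split.
  + by move=> s _; case: (is_derive_stepat e c s).
  + by apply: cvg_at_right_filter; exact: continuous_stepat.
  + by apply: cvg_at_left_filter; exact: continuous_stepat.
- by move=> s _; rewrite derive1E; case: (is_derive_stepat e c s).
Qed.

Lemma integral_indic_itv (c l : R) : 0 <= l ->
  (\int[mu]_s (\1_`[c, (c + l)%R] s)%:E = l%:E)%E.
Proof.
move=> l0; rewrite integral_indic//= setIT lebesgue_measure_itv/= lte_fin.
rewrite ltrDl; case: ltP => [_|l1]; first by rewrite -EFinB addrAC subrr add0r.
by congr EFin; apply/eqP; rewrite eq_le l0 l1.
Qed.

(** The primitive of the difference of two bumps: testing the equation with a
    plateau turns a partial derivative into a difference of two local means. *)
Definition plateau e c h s : R := stepat e c s - stepat e (c + h) s.

Lemma nderivable_plateau e c h n : nderivable n (plateau e c h).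
Proof.
rewrite (_ : plateau e c h = fun s => stepat e c s + -1 * stepat e (c + h) s).
  by apply: nderivable_add; [|apply: nderivable_mul; first exact: nderivable_cst];
    exact: nderivable_stepat.
by apply/funext => s; rewrite mulN1r.
Qed.

Lemma is_derive_plateau e c h s : is_derive s (1 : R) (plateau e c h)
  (bumpat e c s - bumpat e (c + h) s).
Proof. by apply: is_deriveB; exact: is_derive_stepat. Qed.

Lemma plateau_ge0 e c h s : 0 < e -> 0 <= h -> 0 <= plateau e c h s.
Proof.
move=> e0 h0; rewrite /plateau subr_ge0 /stepat; apply: step_homo.
by rewrite !stepat_arg// ler_pM2r ?invr_gt0//; lra.
Qed.

Lemma plateau_out e c h s : 0 < e -> 0 <= h -> (s < c) || (c + (h + e) < s) ->
  plateau e c h s = 0.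
Proof.
move=> e0 h0 /orP[sc|sc]; rewrite /plateau.
  by rewrite !stepat_le ?subrr//; lra.
by rewrite !stepat_ge ?subrr//; lra.
Qed.

Lemma plateau_le_indic e c h s : 0 < e -> 0 <= h ->
  plateau e c h s <= \1_`[c, c + (h + e)] s.
Proof.
move=> e0 h0; rewrite indicE; case: (boolP (s \in _)) => [_|].
  rewrite /plateau (le_trans _ (step_le1 (e^-1 * s + - (e^-1 * c))))//.
  by rewrite gerBl step_ge0.
rewrite notin_setE/= in_itv/= => /negP; rewrite negb_and -!ltNge => sc.
by rewrite plateau_out.
Qed.

End Integrals.

(** * From a weak derivative bound to increments *)

Section Increment.
Variable R : realType.
Local Notation leb2 := (@leb2 R).

Definition pt (k : bool) (s t : R) : R * R := if k then (t, s) else (s, t).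

Lemma ptE k x : exists s t, x = pt k s t.
Proof.
by case: k; [exists x.2, x.1|exists x.1, x.2]; case: x.
Qed.

Lemma tensor_pt k p q s t : tensor k p q (pt k s t) = p s * q t :> R.
Proof. by case: k; rewrite /tensor/= // mulrC. Qed.

Lemma continuous_pt k (f : R * R -> R) c d w : {for pt k c d, continuous f} -> 0 < w ->
  exists2 e, 0 < e & forall s t, c <= s <= c + e -> d <= t <= d + e ->
    `|f (pt k s t) - f (pt k c d)| <= w.
Proof.
move=> cf w0; have := cf => /cvgrPdist_le/(_ _ w0)/nbhs_ballP[e /= e0 H].
exists (e / 2); first by rewrite divr_gt0.
move=> s t /andP[s1 s2] /andP[t1 t2]; rewrite distrC; apply: H.
have hs : ball c e s by rewrite /ball/= distrC ger0_norm ?subr_ge0//; lra.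
have ht : ball d e t by rewrite /ball/= distrC ger0_norm ?subr_ge0//; lra.
by case: (k); split.
Qed.

(** The weak form of [|D_k f| <= g].  The function [H] plays the role of
    [f * D_k psi + (D_k f) * psi], whose integral vanishes. *)
Definition weak_slope (k : bool) (f g : R * R -> R) : Prop :=
  forall psi, smooth psi -> compact (closure [set x | psi x != 0]) ->
  exists H N, [/\ measurable (N : set (measurableTypeR R * measurableTypeR R)),
    leb2 N = 0%E, Rintegral leb2 setT H = 0 &
    forall x, ~ N x -> `|H x - f x * 'D_(axis R k) psi x| <= g x * `|psi x|].

Lemma Rintegral_lincomb3 (f0 f1 f2 : R * R -> R) (a b c r0 r1 r2 : R) :
  leb2.-integrable setT (EFin \o f0) -> leb2.-integrable setT (EFin \o f1) ->
  leb2.-integrable setT (EFin \o f2) ->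
  Rintegral leb2 setT f0 = r0 -> Rintegral leb2 setT f1 = r1 ->
  Rintegral leb2 setT f2 = r2 ->
  let f x := a * f0 x + b * f1 x + c * f2 x in
  leb2.-integrable setT (EFin \o f) /\
  Rintegral leb2 setT f = a * r0 + b * r1 + c * r2.
Proof.
move=> i0 i1 i2 <- <- <- f.
have iZ r g : leb2.-integrable setT (EFin \o g) ->
    leb2.-integrable setT (EFin \o (fun x => r * g x)).
  by move=> ig; exact: (integrableZl measurableT r ig).
have iD g1 g2 : leb2.-integrable setT (EFin \o g1) ->
    leb2.-integrable setT (EFin \o g2) ->
    leb2.-integrable setT (EFin \o (fun x => g1 x + g2 x)).
  by move=> h1 h2; exact: (integrableD measurableT h1 h2).
split; first by apply: (iD); [apply: (iD)|]; exact: (iZ).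
rewrite RintegralD//; [|by apply: (iD); exact: (iZ)|exact: (iZ)].
rewrite RintegralD//; [|exact: (iZ)|exact: (iZ)].
by rewrite !RintegralZl.
Qed.

(** Near each of the two bumps [f] is within [w] of its value there, and the
    lower-order term is at most [B] on the support of the plateau. *)
Lemma plateau_sandwich k f g (c d h e B w f0 f1 : R) x Hx : 0 < e -> 0 <= h -> 0 <= B ->
  (forall s t, c <= s <= c + e -> d <= t <= d + e -> `|f (pt k s t) - f0| <= w) ->
  (forall s t : R, c + h <= s <= c + h + e -> d <= t <= d + e -> `|f (pt k s t) - f1| <= w) ->
  (forall s t, c <= s <= c + (h + e) -> d <= t <= d + e -> g (pt k s t) <= B) ->
  let T p := tensor k p (bumpat e d) x in
  `|Hx - f x * T (fun s => bumpat e c s - bumpat e (c + h) s)| <=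
    g x * `|T (plateau e c h)| ->
  (f0 - w) * T (bumpat e c) + - (f1 + w) * T (bumpat e (c + h)) +
    - B * T \1_`[c, c + (h + e)] <= Hx <=
  (f0 + w) * T (bumpat e c) + - (f1 - w) * T (bumpat e (c + h)) +
    B * T \1_`[c, c + (h + e)].
Proof.
move=> e0 h0 B0 near0 near1 gB T; rewrite {}/T; have [s [t ->]] := ptE k x.
rewrite !tensor_pt.
set b := bumpat e d t; set a := plateau e c h s; set I := \1__ s.
have b0 : 0 <= b by exact: bumpat_ge0.
have a0 : 0 <= a by exact: plateau_ge0.
have aI : a <= I by exact: plateau_le_indic.
have I0 := le_trans a0 aI.
have bI : b != 0 -> d <= t <= d + e.
  move=> bn0; have := contra_neqN (bumpat_out (c := d) e0) bn0.
  by rewrite negb_or -!leNgt.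
have gab : g (pt k s t) * `|a * b| <= B * (I * b).
  have [->|an0] := eqVneq a 0.
    rewrite mul0r normr0 mulr0; exact: (mulr_ge0 B0 (mulr_ge0 I0 b0)).
  have [->|bn0] := eqVneq b 0; first by rewrite !mulr0 normr0 mulr0.
  have sI : c <= s <= c + (h + e).
    have := contra_neqN (plateau_out e0 h0) an0.
    by rewrite negb_or -!leNgt.
  have ab0 := mulr_ge0 a0 b0.
  have gB' : g (pt k s t) <= B by apply: gB => //; exact: bI.
  rewrite (ger0_norm ab0); apply: (le_trans (ler_wpM2r ab0 gB')).
  exact/ler_wpM2l/ler_wpM2r.
have near_point c' f' (p := bumpat e c' s * b) :
    (forall s t, c' <= s <= c' + e -> d <= t <= d + e -> `|f (pt k s t) - f'| <= w) ->
    (f' - w) * p <= f (pt k s t) * p <= (f' + w) * p.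
  move=> near_f'; have p0 : 0 <= p by rewrite mulr_ge0 ?bumpat_ge0.
  have [->|] := eqVneq p 0; first by rewrite !mulr0 lexx.
  rewrite mulf_eq0 negb_or => /andP[sn0 /bI tI].
  have := contra_neqN (bumpat_out (c := c') e0) sn0.
  rewrite negb_or -!leNgt => sI.
  have := near_f' _ _ sI tI; rewrite ler_distl => /andP[h1 h2].
  by rewrite !ler_wpM2r//.
have {near_point near0 near1} := (near_point _ _ near0, near_point _ _ near1).
move: gab; clear; rewrite ler_norml.
move: (g _ * _) (I * b) (f _) (bumpat e c s) (bumpat e (c + h) s).
move=> G Ib F p q hG [/andP[m1 m2] /andP[m3 m4]] /andP[h1 h2].
by apply/andP; split; lra.
Qed.

(** Test with a plateau of length [h] along the axis [k] times a bump across it,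
    with ramps and bump of width [e], and let [e] tend to 0: the bumps have mass 1, so the
    derivative term tends to the increment of [f], while the plateau times the
    transverse bump has mass at most [h + e]. *)
Lemma weak_slope_increment k f g (c d h e0 B : R) : weak_slope k f g ->
  continuous f -> 0 <= h -> 0 < e0 -> 0 <= B ->
  (forall s t, c <= s <= c + (h + e0) -> d <= t <= d + e0 -> g (pt k s t) <= B) ->
  `|f (pt k (c + h) d) - f (pt k c d)| <= B * h.
Proof.
move=> Hf cf h0 e00 B0 gB; apply/ler_addgt0Pr => w' w'0.
(* the two errors [w] of the bumps and the excess [B * e] of the mass add up to
   at most [w'] *)
pose w := w' / (2 + B).
have w0 : 0 < w by rewrite divr_gt0// ltr_pwDl.
have -> : w' = 2 * w + B * w by rewrite /w; field; rewrite gt_eqF// ltr_pwDl.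
have [ea ea0 Ha] := continuous_pt (cf (pt k c d)) w0.
have [eb eb0 Hb] := continuous_pt (cf (pt k (c + h) d)) w0.
pose e := Num.min (Num.min ea eb) (Num.min e0 w).
have e_gt0 : 0 < e by rewrite !lt_min ea0 eb0 e00 w0.
have eea : e <= ea by rewrite !ge_min lexx.
have eeb : e <= eb by rewrite !ge_min lexx !orbT.
have eee : e <= e0 by rewrite !ge_min lexx !orbT.
have eew : e <= w by rewrite !ge_min lexx !orbT.
have widen r y z : e <= r -> y <= z <= y + e -> y <= z <= y + r.
  by move=> er /andP[-> zy]; rewrite (le_trans zy)// lerD2l.
have compact_support : compact
    (closure [set x | tensor k (plateau e c h) (bumpat e d) x != 0]).
  apply: (@compact_closure_box _ _ (`|c| + `|d| + h + e)) => x /=.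
  have [s [t ->]] := ptE k x.
  rewrite tensor_pt mulf_eq0 negb_or => /andP[sn0 tn0].
  have := contra_neqN (plateau_out e_gt0 h0) sn0.
  have := contra_neqN (bumpat_out (c := d) e_gt0) tn0.
  rewrite !negb_or -!leNgt => /andP[t1 t2] /andP[s1 s2].
  have := ler_norm c; have := ler_norm (- c); have := ler_norm d.
  have := ler_norm (- d); rewrite !normrN => *.
  by case: (k) => /=; split; lra.
have sm : smooth (tensor k (plateau e c h) (bumpat e d)).
  by apply: smooth_tensor => n; [exact: nderivable_plateau | exact: nderivable_bumpat].
have [H [N [mN N0 IH HN]]] := Hf _ sm compact_support.
have mb c' : measurable_fun setT (bumpat e c').
  by apply: continuous_measurable_fun; exact: continuous_bumpat.
have bge c' s : 0 <= bumpat e c' s by exact: bumpat_ge0.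
pose I := \1_`[c, c + (h + e)] : R -> R.
have [i0 I0] := integral_tensor k (mb c) (mb d) (bge c) (bge d)
  (integral_bumpat c e_gt0) (integral_bumpat d e_gt0).
have [i1 I1] := integral_tensor k (mb (c + h)) (mb d) (bge (c + h)) (bge d)
  (integral_bumpat (c + h) e_gt0) (integral_bumpat d e_gt0).
have mI : measurable_fun setT I by exact: measurable_indic.
have Ige s : 0 <= I s by rewrite /I indicE.
have he : 0 <= h + e by rewrite addr_ge0// ltW.
have [i2 I2] := integral_tensor k mI (mb d) Ige (bge d)
  (integral_indic_itv c he) (integral_bumpat d e_gt0).
set f0 := f (pt k c d); set f1 := f (pt k (c + h) d).
have [il Il] := Rintegral_lincomb3 (f0 - w) (- (f1 + w)) (- B) i0 i1 i2 I0 I1 I2.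
have [iu Iu] := Rintegral_lincomb3 (f0 + w) (- (f1 - w)) B i0 i1 i2 I0 I1 I2.
have : (f0 - w) * (1 * 1) + - (f1 + w) * (1 * 1) + - B * ((h + e) * 1) <=
   Rintegral leb2 setT H <=
   (f0 + w) * (1 * 1) + - (f1 - w) * (1 * 1) + B * ((h + e) * 1).
  rewrite -Il -Iu; apply: (Rintegral_squeeze mN N0 il iu) => x /HN.
  have [_ ->] := is_derive_tensor k (bumpat e d) x (is_derive_plateau e c h).
  apply: plateau_sandwich => //.
  - by move=> s t /(widen _ _ _ eea) sI /(widen _ _ _ eea); exact: Ha.
  - by move=> s t /(widen _ _ _ eeb) sI /(widen _ _ _ eeb); exact: Hb.
  - move=> s t /andP[s1 s2] /(widen _ _ _ eee); apply: gB.
    by rewrite s1 (le_trans s2)// !lerD2l.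
have : B * e <= B * w by rewrite ler_wpM2l.
rewrite IH !mulr1; clear => hB /andP[h1 h2].
by rewrite ler_norml; apply/andP; split; lra.
Qed.

End Increment.

(** * The Dirac equation for real spinors *)

Section Dirac.
Variable R : realType.
Local Notation leb2 := (@leb2 R).
Implicit Types (A : 'M[R[i]]_2) (v w : 'cV[R[i]]_2) (x : R * R).

Lemma normc_ge_ReIm (z : R[i]) :
  `|complex.Re z| <= Normc.normc z /\ `|complex.Im z| <= Normc.normc z.
Proof.
case: z => a b /=; rewrite -!sqrtr_sqr.
by split; rewrite ler_sqrt ?lerDl ?lerDr ?addr_ge0 ?sqr_ge0.
Qed.

Lemma normc_ge0 (z : R[i]) : 0 <= Normc.normc z.
Proof. by case: z => a b; exact: sqrtr_ge0. Qed.

Lemma normc_le_cnorm v j : Normc.normc (v j 0) <= cnorm v.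
Proof.
rewrite /cnorm -(ger0_norm (normc_ge0 _)) -sqrtr_sqr ler_sqrt; last first.
  by rewrite sumr_ge0// => i _; rewrite sqr_ge0.
by rewrite (bigD1 j)//= lerDl sumr_ge0// => i _; rewrite sqr_ge0.
Qed.

Lemma cnorm_ge0 v : 0 <= cnorm v.
Proof. exact: sqrtr_ge0. Qed.

Lemma cnorm_le_sum v : cnorm v <= \sum_j Normc.normc (v j 0).
Proof.
rewrite /cnorm -[leRHS]ger0_norm -?sqrtr_sqr; last first.
  by rewrite sumr_ge0// => i _; exact: normc_ge0.
rewrite ler_sqrt ?sqr_ge0// !big_ord_recl !big_ord0 !addr0.
rewrite sqrrD -addrA lerD2l lerDr mulrn_wge0// mulr_ge0//; exact: normc_ge0.
Qed.

Lemma cnormZ (z : R[i]) v : cnorm (z *: v) = Normc.normc z * cnorm v.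
Proof.
rewrite /cnorm; under eq_bigr do rewrite mxE Normc.normcM exprMn.
by rewrite -mulr_sumr sqrtrM ?sqr_ge0// sqrtr_sqr ger0_norm ?normc_ge0.
Qed.

Lemma cnorm0 : cnorm (0 : 'cV[R[i]]_2) = 0.
Proof. by rewrite -(scale0r (0 : 'cV[R[i]]_2)) cnormZ Normc.normc0 mul0r. Qed.

Lemma cnorm_eq0 v : cnorm v = 0 -> v = 0.
Proof.
move=> v0; apply/colP => j; rewrite mxE; apply: Normc.eq0_normc.
by apply/le_anti; rewrite normc_ge0 -v0 normc_le_cnorm.
Qed.

Lemma cnorm_mulmx_le A v : cnorm (A *m v) <= opnorm A * cnorm v.
Proof.
have [v0|vn0] := eqVneq (cnorm v) 0.
  by rewrite (cnorm_eq0 v0) mulmx0 cnorm0 mulr0.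
have vp : 0 < cnorm v by rewrite lt0r vn0 cnorm_ge0.
pose c : R[i] := ((cnorm v)^-1)%:C%C.
have nc : Normc.normc c = (cnorm v)^-1.
  by rewrite /= expr0n/= addr0 sqrtr_sqr ger0_norm ?invr_ge0 ?cnorm_ge0.
rewrite -ler_pdivrMr// mulrC -nc -cnormZ scalemxAr.
apply: ub_le_sup; last first.
  by exists (c *: v) => //=; rewrite cnormZ nc mulVf.
exists (\sum_j \sum_k Normc.normc (A j k)) => _ [w /= w1 <-].
apply: (le_trans (cnorm_le_sum _)); apply: ler_sum => j _.
rewrite mxE; elim/big_ind2 : _ => [|y1 z1 y2 z2 h1 h2|k _].
- by rewrite Normc.normc0.
- by rewrite (le_trans (le_normcD _ _))// lerD.
- rewrite Normc.normcM -[leRHS]mulr1; apply: ler_wpM2l; first exact: normc_ge0.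
  by rewrite (le_trans (normc_le_cnorm w k)).
Qed.

(** The slack [1] makes the bound positive even when [V] vanishes. *)
Lemma ae_opnorm_le (V : R * R -> 'M[R[i]]_2) : (Linf_norm V < +oo)%E ->
  exists N, [/\ measurable (N : set (measurableTypeR R * measurableTypeR R)),
    leb2 N = 0%E & forall x, ~ N x -> opnorm (V x) <= fine (Linf_norm V) + 1].
Proof.
move=> Voo; have : (Linf_norm V <= (fine (Linf_norm V) + 1)%:E)%E.
  move: Voo; case: (Linf_norm V) => [r|//|]; last by rewrite leNye.
  by rewrite lee_fin lerDl.
move: (fine _ + 1) => m; rewrite {1}/Linf_norm unlock.
case: ifPn => [_|].
  move=> /ess_supP[N [mN N0 HN]]; exists N; split => // x Nx.
  apply: contrapT => h; apply: Nx; apply: HN => /= h'; apply: h.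
  by move: h'; rewrite /= lee_fin; apply: le_trans; exact: ler_norm.
rewrite -leNgt => mu0 _; exists setT; split => // [|x /(_ I)//].
by apply/eqP; rewrite eq_le mu0 measure_ge0.
Qed.

(** When the positive or the negative part has an infinite integral, both sides
    are 0. *)
Lemma Rintegral_opp (h : R * R -> R) :
  Rintegral leb2 setT (fun x => - h x) = - Rintegral leb2 setT h.
Proof.
pose g := EFin \o h; rewrite [LHS](_ : _ = fine (integral leb2 setT (\- g)%E))//.
rewrite [RHS](_ : _ = - fine (integral leb2 setT g))//.
rewrite integralE [X in - fine X]integralE funeposN funenegN {}/g.
have := @integral_ge0 _ _ _ leb2 setT ((EFin \o h)^\+)%E (fun x _ => funepos_ge0 _ x).
have := @integral_ge0 _ _ _ leb2 setT ((EFin \o h)^\-)%E (fun x _ => funeneg_ge0 _ x).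
case: (integral _ _ _) => [a| |]//; case: (integral _ _ _) => [b| |]//= _ _; rewrite ?oppr0//.
by rewrite opprB.
Qed.

(** Each row of the equation involves a single component of the spinor, through
    [-i (d1 - i d2)] or [-i (d1 + i d2)]. *)
Lemma dirac_symbolE (p q : 'cV[R[i]]_2) :
  let w := - 'i%C *: (sigma1 R *m p) - 'i%C *: (sigma2 R *m q) in
  w 0 0 = - 'i%C * p 1 0 - q 1 0 /\ w 1 0 = - 'i%C * p 0 0 + q 0 0.
Proof.
have ii : 'i%C * 'i%C = -1 :> R[i].
  by apply/eqP; rewrite eq_complex /= !(mulr0, mul0r, mulr1, sub0r, addr0) oppr0 !eqxx.
have ord1E : lift ord0 ord0 = 1 :> 'I_2 by apply/val_inj.
move=> w; rewrite {}/w !mxE !big_ord_recl !big_ord0 !mxE /= ord1E.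
rewrite !(mulr0, mul0r, mulr1, mul1r, addr0, add0r).
by split; rewrite ?(mulNr, mulrN) !mulrA ii; ring.
Qed.

(** The test spinor [i * psi] in the component [j]: the Dirac operator sends it
    to [d1 psi +- i d2 psi] in the other component, with real [d1 psi] and
    [d2 psi]. *)
Definition imag_at (j : 'I_2) (psi : R * R -> R) x : 'cV[R[i]]_2 :=
  \col_i (if i == j then 0 +i* psi x else 0)%C.

Lemma smooth0 : smooth (fun=> 0 : R).
Proof.
elim=> [|n IH]; first by split => // x; exact: cvg_cst.
have d (a x : R * R) : is_derive x a (fun=> 0 : R) 0 by exact: is_derive_cst.
split; first by move=> x; exact: cvg_cst.
by split => [x|x||]; [case: (d (e1 R) x)|case: (d (e2 R) x)| |];
  rewrite (_ : (fun x => _) = fun=> 0)//; apply/funext => x;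
  [case: (d (e1 R) x)|case: (d (e2 R) x)].
Qed.

Lemma test_imag_at j psi i : smooth psi -> compact (closure [set x | psi x != 0]) ->
  test_function (fun x => imag_at j psi x i 0).
Proof.
move=> sm cp; rewrite (_ : (fun x => _) = fun x => (if i == j then 0 +i* psi x else 0)%C); last first.
  by apply/funext => x; rewrite mxE.
case: eqP => _; split => //=; try exact: smooth0.
  rewrite (_ : [set x | _] = [set x | psi x != 0])//.
  by apply/seteqP; split => x /=; rewrite eq_complex/= eqxx.
rewrite (_ : [set x | _] = set0) ?closure0; first exact: compact0.
by apply/seteqP; split => x //=; rewrite eqxx.
Qed.

Lemma cderive_imag_at (a : R * R) j psi i x :
  cderive a (fun y => imag_at j psi y i 0) x =
    (if i == j then 0 +i* 'D_a psi x else 0)%C.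
Proof.
rewrite (_ : (fun y => _) = fun y => (if i == j then 0 +i* psi y else 0)%C); last first.
  by apply/funext => y; rewrite mxE.
by rewrite /cderive; case: eqP => _ /=; rewrite !derive_cst.
Qed.

Definition weak_integrand (V : R * R -> 'M[R[i]]_2) (U phi : R * R -> 'cV[R[i]]_2) x : R[i] :=
  cdot (U x) (dirac2 phi x) + cdot (V x *m U x) (phi x).

(** This is where real-valuedness enters: since the [i]-th component of [U] is
    real, the two partial derivatives separate into the real and the imaginary
    part of a single complex equation. *)
Lemma weak_integrand_imag_at V U (j : 'I_2) psi x :
  let i := if j == 0 then 1 else 0 in
  let e := if j == 0 then -1 else 1 in
  let W := (V x *m U x) j 0 in
  complex.Im (U x i 0) = 0 ->
  complex.Re (weak_integrand V U (imag_at j psi) x) =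
    complex.Re (U x i 0) * 'D_(axis R false) psi x + complex.Im W * psi x /\
  complex.Im (weak_integrand V U (imag_at j psi) x) =
    e * (complex.Re (U x i 0) * 'D_(axis R true) psi x) - complex.Re W * psi x.
Proof.
move=> i e W; rewrite {}/i {}/e {}/W /weak_integrand /cdot /dirac2.
have DE a i : pderive a (imag_at j psi) x i 0 = (if i == j then 0 +i* 'D_a psi x else 0)%C.
  by rewrite mxE cderive_imag_at.
have phiE i : imag_at j psi x i 0 = (if i == j then 0 +i* psi x else 0)%C by rewrite mxE.
have ord1E : lift ord0 ord0 = 1 :> 'I_2 by apply/val_inj.
have [j0|j1] : j = 0 \/ j = 1 by case: (j) => [[|[|//]]] ?; [left|right]; exact/val_inj.
all: move: (pderive (e1 R) _ x) (DE (e1 R)) (pderive (e2 R) _ x) (DE (e2 R)).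
all: move: (imag_at j psi x) phiE (U x) (V x *m U x) => {DE} phi phiE u w p Hp q Hq.
all: have [] := dirac_symbolE p q; move: (_ - _) => d.
all: rewrite !big_ord_recl !big_ord0 !addr0 ord1E /axis => -> -> /=.
all: move: {phiE Hp Hq} (Hp 0) (Hp 1) (Hq 0) (Hq 1) (phiE 0) (phiE 1).
all: rewrite ?j0 ?j1 /= => -> -> -> -> -> ->.
all: move: ('D_(e1 R) psi x) ('D_(e2 R) psi x) (psi x) => D1 D2 r.
all: case: (u 0 0) => a b; case: (u 1 0) => a' b' /= ->.
all: case: (w 0 0) => c c'; case: (w 1 0) => c1 c1' /=.
all: by split; ring.
Qed.

(** Weak form of [|D_k U_i| <= |V U| <= (|V|_oo + 1) |U|]: an elliptic first
    order system in general, it controls the full gradient when [U] is real. *)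
Lemma dirac_weak_slope V U i k : (Linf_norm V < +oo)%E -> weak_solution V U ->
  (forall x j, complex.Im (U x j 0) = 0) ->
  weak_slope k (fun x => complex.Re (U x i 0))
    (fun x => (fine (Linf_norm V) + 1) * cnorm (U x)).
Proof.
move=> Voo sol Ureal psi sm cp.
have [N [mN N0 VN]] := ae_opnorm_le Voo.
pose j : 'I_2 := if i == 0 then 1 else 0.
have ij : i = if j == 0 then 1 else 0.
  by rewrite /j; case: (i) => [[|[|//]]] ?; exact/val_inj.
pose F := weak_integrand V U (imag_at j psi).
have /eqP := sol (imag_at j psi) (fun l => test_imag_at j l sm cp).
rewrite eq_complex => /andP[/= /eqP ReF /eqP ImF].
pose e : R := if j == 0 then -1 else 1.
have e2 : e * e = 1 by rewrite /e; case: ifP => _; rewrite ?mulrNN mulr1.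
exists (fun x => if k then e * complex.Im (F x) else complex.Re (F x)), N; split => //.
  case: k; last exact: ReF.
  rewrite /e; case: ifP => _.
    by under eq_Rintegral do rewrite mulN1r; rewrite Rintegral_opp ImF oppr0.
  by under eq_Rintegral do rewrite mul1r; exact: ImF.
move=> x Nx; pose W := (V x *m U x) j 0.
have WM : Normc.normc W <= (fine (Linf_norm V) + 1) * cnorm (U x).
  apply: (le_trans (normc_le_cnorm _ _)); apply: (le_trans (cnorm_mulmx_le _ _)).
  by rewrite ler_wpM2r ?cnorm_ge0 ?VN.
have [W1 W2] := normc_ge_ReIm W.
have Uj : complex.Im (U x (if j == 0 then 1 else 0) 0) = 0 by [].
have [] := weak_integrand_imag_at V psi Uj; rewrite -ij -/F -/W -/e => EqRe EqIm.
case: k.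
  rewrite EqIm mulrBr mulrA e2 mul1r addrAC subrr add0r normrN !normrM.
  have -> : `|e| = 1 by rewrite /e; case: ifP => _; rewrite ?normrN normr1.
  by rewrite mul1r ler_wpM2r// (le_trans W1).
by rewrite EqRe addrAC subrr add0r normrM ler_wpM2r// (le_trans W2).
Qed.

End Dirac.

(** * Discrete Gronwall argument along axis-parallel paths *)

Section Gronwall.
Variable R : realType.
Variables (f : 'I_2 -> R * R -> R) (M K : R).
Implicit Types (k : bool) (c d s t h : R).

Let w (x : R * R) : R := \sum_i `|f i x|.

Hypothesis M0 : 0 < M.
Hypothesis cf : forall i, continuous (f i).
Hypothesis slope : forall i k, weak_slope k (f i) (fun x => M * w x).
Hypothesis wK : forall x, w x <= K.

Lemma sum_norm_ge0 x : 0 <= w x.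
Proof. by rewrite sumr_ge0. Qed.

Let K0 : 0 <= K := le_trans (sum_norm_ge0 (0, 0)) (wK (0, 0)).

Lemma sum_norm_le_shift x y (D : R) : (forall i, `|f i x - f i y| <= D) -> w x <= w y + 2 * D.
Proof.
move=> H; rewrite mulr_natl.
have -> : D *+ 2 = \sum_(i < 2) D by rewrite sumr_const card_ord.
rewrite -big_split/= ler_sum// => i _.
by rewrite -lerBlDl (le_trans _ (H i))// lerB_dist.
Qed.

(** A crude global estimate, used only to pass from a bound of [w] on a segment
    to a bound on a thin neighbourhood of it. *)
Lemma lipschitz i k c d h : 0 <= h ->
  `|f i (pt k (c + h) d) - f i (pt k c d)| <= M * K * h.
Proof.
move=> h0; apply: (weak_slope_increment (@slope i k) (@cf i) h0 ltr01).
  by rewrite mulr_ge0// ltW.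
by move=> s t _ _; rewrite ler_wpM2l// ltW.
Qed.

Lemma pt_flip k s t : pt (~~ k) t s = pt k s t.
Proof. by case: k. Qed.

(** [weak_slope_increment] needs a bound of [w] on a rectangle; by [lipschitz]
    a bound [S] on the segment gives [S + 4 M K e] on the rectangle of width
    [e], and [e] is arbitrary. *)
Lemma segment_increment i k c d h (S : R) : 0 <= h ->
  (forall s, c <= s <= c + h -> w (pt k s d) <= S) ->
  `|f i (pt k (c + h) d) - f i (pt k c d)| <= M * S * h.
Proof.
move=> h0 wS; apply/ler_addgt0Pr => t t0.
have S0 : 0 <= S by rewrite (le_trans (sum_norm_ge0 (pt k c d)))// wS ?lexx ?lerDl.
pose L := M * K.
have L0 : 0 <= L by rewrite mulr_ge0// ltW.
have q0 : 0 < 4 * M * L * h + 1.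
  by rewrite ltr_wpDl// !mulr_ge0// ltW.
(* chosen so that the excess [M * (4 * L * e) * h] is at most [t] *)
pose e := t / (4 * M * L * h + 1).
have e0 : 0 < e by rewrite divr_gt0.
have le_t : M * (S + 4 * L * e) * h <= M * S * h + t.
  have -> : M * (S + 4 * L * e) * h = M * S * h + (4 * M * L * h) * e by ring.
  rewrite lerD2l /e mulrCA; apply: ler_piMr; first exact: ltW.
  by rewrite ler_pdivrMr// mul1r lerDl.
apply: le_trans le_t.
apply: (weak_slope_increment (@slope i k) (@cf i) h0 e0).
  apply: mulr_ge0; first exact: ltW.
  apply: addr_ge0 => //; apply: mulr_ge0; last exact: ltW.
  exact: mulr_ge0.
move=> s' t' /andP[cs sc] /andP[dt td].
rewrite ler_wpM2l ?(ltW M0)//.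
pose s1 := Num.min s' (c + h).
have s1s : s1 <= s' by rewrite ge_min lexx.
have s1c : c <= s1 <= c + h by rewrite le_min cs lerDl h0 ge_min lexx orbT.
have ss1 : s' <= s1 + e
  by rewrite /s1; case: (leP s' (c + h)) => _; [rewrite lerDl ltW | rewrite -addrA].
have hs : w (pt k s' d) <= w (pt k s1 d) + 2 * (L * e).
  apply: sum_norm_le_shift => j; have h1 : 0 <= s' - s1 by rewrite subr_ge0.
  have := lipschitz j k s1 d h1; rewrite (subrKC s1) => /le_trans; apply.
  by rewrite ler_wpM2l// lerBlDl.
have ht : w (pt k s' t') <= w (pt k s' d) + 2 * (L * e).
  apply: sum_norm_le_shift => j; have h1 : 0 <= t' - d by rewrite subr_ge0.
  have := lipschitz j (~~ k) d s' h1; rewrite (subrKC d) !pt_flip => /le_trans; apply.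
  by rewrite ler_wpM2l// lerBlDl.
have := wS _ s1c; lra.
Qed.

(** Let [S] be the supremum of [w] on a segment of length at most [1 / (4 M)].
    Each of the two components varies by at most [M S h <= S / 4] on it, so [w]
    varies by at most [S / 2], and [S <= 2 w] at every point of the segment. *)
Lemma doubling k c d h : 0 <= h -> 4 * M * h <= 1 ->
  w (pt k c d) <= 2 * w (pt k (c + h) d) /\ w (pt k (c + h) d) <= 2 * w (pt k c d).
Proof.
move=> h0 Mh.
pose A := [set w (pt k s d) | s in [set s | c <= s <= c + h]].
pose S := sup A.
have hA : has_sup A.
  split; first by exists (w (pt k c d)), c => //=; rewrite lexx lerDl.
  by exists K => _ [s _ <-].
have wS s : c <= s <= c + h -> w (pt k s d) <= S.
  by move=> hs; apply: ub_le_sup; [exact: hA.2 | exists s].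
have S0 : 0 <= S by rewrite (le_trans (sum_norm_ge0 (pt k c d)))// wS ?lexx ?lerDl.
have half s r : c <= s -> s <= r -> r <= c + h ->
    w (pt k s d) <= w (pt k r d) + S / 2 /\ w (pt k r d) <= w (pt k s d) + S / 2.
  move=> cs sr rc.
  have inc i : `|f i (pt k r d) - f i (pt k s d)| <= S / 4.
    have sr0 : 0 <= r - s by rewrite subr_ge0.
    have := @segment_increment i k s d (r - s) S sr0; rewrite (subrKC s).
    move=> /(_ _)/le_trans; apply.
      by move=> s' /andP[? ?]; apply: wS; apply/andP; split; lra.
    have rsh : r - s <= h by lra.
    have Mrs : M * (r - s) <= 4^-1.
      have := ler_wpM2l (ltW M0) rsh; lra.
    by rewrite mulrAC mulrC; exact: ler_wpM2l.
  have -> : S / 2 = 2 * (S / 4) by field.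
  by split; apply: sum_norm_le_shift => i; rewrite // distrC.
have Sle r : c <= r <= c + h -> S <= 2 * w (pt k r d).
  move=> /andP[cr rc]; suff : S <= w (pt k r d) + S / 2 by lra.
  apply: ge_sup; first exact: hA.1.
  move=> _ [s /andP[cs sc] <-]; case: (leP s r) => sr.
    by case: (half s r cs sr rc).
  by case: (half r s cr (ltW sr) sc).
have c1 : c <= c <= c + h by rewrite lexx lerDl.
have c2 : c <= c + h <= c + h by rewrite lexx lerDl h0.
by split; [exact: le_trans (wS _ c1) (Sle _ c2) | exact: le_trans (wS _ c2) (Sle _ c1)].
Qed.

(** The segment from [c] to [s] is cut into [n] equal steps. *)
Lemma chain k (n : nat) c d s : 4 * M * `|s - c| <= n%:R ->
  w (pt k c d) <= 2 ^+ n * w (pt k s d).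
Proof.
elim: n s => [|n IH] s sn.
  have -> : s = c; last by rewrite expr0 mul1r.
  apply/eqP; rewrite -subr_eq0 -normr_le0 -(pmulr_rle0 _ (_ : 0 < 4 * M))//.
  by rewrite mulr_gt0.
pose q := n.+1%:R^-1 : R.
have q0 : 0 < q by rewrite invr_gt0 ltr0n.
pose s1 := s - (s - c) * q.
have d1 : 4 * M * `|s - s1| <= 1.
  have -> : s - s1 = (s - c) * q by rewrite /s1; ring.
  by rewrite normrM (ger0_norm (ltW q0)) mulrA ler_pdivrMr ?mul1r ?ltr0n.
have s1n : 4 * M * `|s1 - c| <= n%:R.
  have -> : s1 - c = (s - c) * (n%:R * q).
    by rewrite /s1 /q -natr1; field; rewrite natr1 pnatr_eq0.
  rewrite normrM (ger0_norm (mulr_ge0 _ (ltW q0)))// (mulrC n%:R) !mulrA.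
  by apply: ler_piMl => //; rewrite ler_pdivrMr ?mul1r ?ltr0n.
apply: (le_trans (IH _ s1n)); rewrite exprSr -mulrA ler_wpM2l ?exprn_ge0//.
have [ss|ss] := leP s1 s.
  have h0 : 0 <= s - s1 by rewrite subr_ge0.
  rewrite (ger0_norm h0) in d1.
  by have [] := doubling k s1 d h0 d1; rewrite (subrKC s1).
have h0 : 0 <= s1 - s by rewrite subr_ge0 ltW.
rewrite distrC (ger0_norm h0) in d1.
by have [] := doubling k s d h0 d1; rewrite (subrKC s).
Qed.

(** Follow the path from the origin to [(x.1, 0)] and then to [x]: each leg takes
    at most [4 M r + 1] doublings, and [2 <= exp 1]. *)
Lemma exp_lower_bound x (r : R) : 0 <= r -> `|x.1| <= r -> `|x.2| <= r ->
  w (0, 0) * expR (- (8 * M * r + 2)) <= w x.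
Proof.
move=> r0 x1 x2; pose n := (Num.truncn (4 * M * r)).+1.
have Mr0 : 0 <= 4 * M * r by rewrite !mulr_ge0// ltW.
have /andP[n1 n2] := truncn_itv Mr0.
have M4 : 0 <= 4 * M by rewrite mulr_ge0// ltW.
have nle (y : R) : `|y| <= r -> 4 * M * `|y - 0| <= n%:R.
  by move=> yr; rewrite subr0 (le_trans (ler_wpM2l M4 yr))// ltW.
have h1 := @chain false n 0 0 x.1 (nle _ x1).
have h2 := @chain true n 0 x.1 x.2 (nle _ x2).
rewrite /pt/= -surjective_pairing in h1 h2.
rewrite expRN ler_pdivrMr ?expR_gt0//.
apply: (le_trans h1); apply: (le_trans (ler_wpM2l _ h2)); first exact: exprn_ge0.
rewrite mulrA mulrC ler_wpM2l ?sum_norm_ge0//.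
have e2 : 2 <= expR 1 :> R by have := expR_ge1Dx (1 : R); lra.
apply: (@le_trans _ _ (expR 1 ^+ n * expR 1 ^+ n)).
  by apply: ler_pM; rewrite ?exprn_ge0//; apply: lerXn2r; rewrite ?nnegrE ?expR_ge0.
have {}n1 : n%:R <= 4 * M * r + 1 by rewrite /n -[leLHS]natr1 lerD2r.
rewrite -!expRM_natl -expRD ler_expR !mulr1; lra.
Qed.

End Gronwall.

(** * From pointwise bounds to the minimal local supremum *)

Section Conclusion.
Variable R : realType.

Lemma weak_slope_le k (f g g' : R * R -> R) : (forall x, g x <= g' x) ->
  weak_slope k f g -> weak_slope k f g'.
Proof.
move=> gg H psi sm cp; have [F [N [mN N0 IF FN]]] := H psi sm cp.
by exists F, N; split => // x /FN/le_trans; apply; rewrite ler_wpM2r.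
Qed.

Lemma enorm_ge (x : R * R) : `|x.1| <= enorm x /\ `|x.2| <= enorm x.
Proof.
rewrite /enorm -!sqrtr_sqr.
by split; rewrite ler_sqrt ?lerDl ?lerDr ?addr_ge0 ?sqr_ge0.
Qed.

Lemma Mmin_ge (U : R * R -> 'cV[R[i]]_2) (K r b : R) : 0 <= r ->
  (forall x, cnorm (U x) <= K) -> (forall x, enorm x = r -> b <= cnorm (U x)) ->
  b <= Mmin U r.
Proof.
move=> r0 UK Ub; apply: lb_le_inf.
  exists (sup [set cnorm (U y) | y in [set y | enorm (y - (r, 0)) < 1]]), (r, 0) => //=.
  by rewrite /enorm/= expr0n/= addr0 sqrtr_sqr ger0_norm.
move=> _ [x /= xr <-]; apply: (le_trans (Ub x xr)); apply: ub_le_sup.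
  by exists K => _ [y _ <-].
by exists x => //=; rewrite subrr /enorm/= expr0n/= addr0 sqrtr0.
Qed.

End Conclusion.

Theorem theorem4p2 (R : realType) :
  exists kappa : R -> R,
    (forall m, 0 <= m -> 0 < kappa m) /\
    forall (V : R * R -> 'M[R[i]]_2) (U : R * R -> 'cV[R[i]]_2),
      (forall i j, clmeasurable (fun x => V x i j)) ->
      (Linf_norm V < +oo)%E ->
      (forall j, H1loc (fun x => U x j 0)) ->
      (* U is the continuous representative of its class *)
      (forall j, ccontinuous (fun x => U x j 0)) ->
      (exists K, forall x, cnorm (U x) <= K) ->
      (forall x j, complex.Im (U x j 0) = 0) ->
      weak_solution V U ->
      cnorm (U (0, 0)) = 1 ->
      exists c R0 : R,
        [/\ 0 < c, 1 < R0 &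
          forall r, R0 <= r ->
            c * expR (- (kappa (fine (Linf_norm V)) * r * ln r)) <= Mmin U r].
Proof.
(* [8] for two legs of [4 M r] doublings each, with [2 <= expR 1];
   [1 <= ln r] from [expR 1] on *)
exists (fun m => 8 * (m + 1)); split; first by move=> m m0; rewrite mulr_gt0// ltr_wpDl.
move=> V U _ Voo _ cU [K UK] Ureal sol U1.
set M := fine (Linf_norm V) + 1.
have M0 : 0 < M by rewrite ltr_wpDl// fine_ge0// Lnorm_ge0.
pose f (j : 'I_2) x := complex.Re (U x j 0).
pose w x := \sum_j `|f j x|.
have normcE x j : Normc.normc (U x j 0) = `|f j x|.
  rewrite /f; have := Ureal x j; case: (U x j 0) => a b /= ->.
  by rewrite expr0n/= addr0 sqrtr_sqr.
have Uw x : cnorm (U x) <= w x.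
  by apply: (le_trans (cnorm_le_sum _)); apply: ler_sum => j _; rewrite normcE.
have wU x : w x <= 2 * cnorm (U x).
  rewrite mulr_natl (_ : _ *+ 2 = \sum_(j < 2) cnorm (U x)); last by rewrite sumr_const card_ord.
  by apply: ler_sum => j _; rewrite -normcE normc_le_cnorm.
have cf j : continuous (f j) by case: (cU j).
have slope j k : weak_slope k (f j) (fun x => M * w x).
  apply: weak_slope_le (dirac_weak_slope j k Voo sol Ureal) => x.
  by rewrite ler_wpM2l// ltW.
have wK x : w x <= 2 * K by rewrite (le_trans (wU x))// ler_wpM2l.
exists (expR (-2) / 2), (expR 1); split.
- by rewrite divr_gt0// expR_gt0.
- by rewrite expR_gt1.
move=> r re; have r1 : 1 <= ln r by rewrite -(expRK 1) ler_ln ?posrE ?expR_gt0// (lt_le_trans (expR_gt0 1)).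
have r0 : 0 <= r by rewrite (le_trans _ re)// expR_ge0.
apply: (Mmin_ge r0 UK) => x xr.
have [x1 x2] := enorm_ge x; rewrite xr in x1 x2.
have low := exp_lower_bound M0 cf slope wK r0 x1 x2.
have Mr0 : 0 <= 8 * M * r by rewrite mulr_ge0// mulr_ge0// ltW.
apply: (@le_trans _ _ (expR (- (8 * M * r + 2)) / 2)).
  rewrite mulrAC ler_wpM2r// -expRD ler_expR.
  have := ler_peMr Mr0 r1; lra.
rewrite ler_pdivrMr// [leRHS]mulrC; apply: le_trans (wU x); apply: le_trans low.
by apply: ler_peMl; [exact: expR_ge0 | rewrite -U1 Uw].
Qed.
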